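(* (i) Let $n$ be a positive integer, let $\zeta$ be a primitive $n$-th root of unity in a field $F$, and let $x_1,\ldots,x_n,x\in F$. Then $$\operatorname{per}\left[1-\zeta^{j}x_k\right]_{1\le j,k\le n}=n!\,(1-x_1\cdots x_n).$$ When $n>1$, we also have $$\operatorname{per}\left[1+\zeta^{j+k}x\right]_{1\le j,k\le n-1}=\sum_{k=0}^{n-1}\frac{(n-1)!}{\binom{n-1}{k}}x^k.$$ (ii) Let $p$ be an odd prime. Then for all integers $x_1,\ldots,x_{p-1}$, $$\operatorname{per}[j+x_k]_{1\le j,k\le p-1}\equiv 1-x_1\cdots x_{p-1}\pmod p.$$ For any integer $d\not\equiv0\pmod p$, we have $$\operatorname{per}[j+dk]_{1\le j,k\le p-1}\equiv d^{p-1}-3-4(p-1)!\pmod{p^2},$$ $$\operatorname{per}[j+dk]_{1\le j,k\le p}\equiv\frac{d+1}{2}\,p\pmod{p^2},$$ $$\operatorname{per}[j+dk]_{0\le j,k\le p-1}\equiv-\frac{d+1}{2}\,p\pmod{p^2}.$$ Provided $p>3$, for any integer $d\not\equiv0\pmod p$ we also have $$\operatorname{per}[j^2+dk^2]_{1\le j,k\le (p-1)/2}\equiv\left(d^{(p-1)/2}+1\right)\left(\frac{p-1}{2}!\right)^3\pmod{p^2},$$ $$\operatorname{per}[j^2+dk^2]_{0\le j,k\le (p-1)/2}\equiv(-1)^{(p-1)/2}\,\frac{p}{24}\left(d+\left(\frac dp\right)\right)\frac{p-1}{2}!\pmod{p^2}.$$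
   Context: The permanent of a square matrix $A=[a_{j,k}]$ is $\operatorname{per}(A)=\sum_{\tau}\prod_{j}a_{j,\tau(j)}$, where $\tau$ runs over all permutations of the index set (which may be $\{1,\ldots,N\}$ or $\{0,1,\ldots,N\}$). In part (i), the integers $(n-1)!/\binom{n-1}{k}=k!\,(n-1-k)!$ are viewed as elements of $F$. $\left(\frac{d}{p}\right)$ denotes the Legendre (Jacobi) symbol, and $\frac{p-1}{2}!$ means $((p-1)/2)!$. Congruences modulo $p^2$ between rational numbers whose denominators are prime to $p$ are understood in the ring of $p$-integral rationals: $a\equiv b\pmod{p^2}$ means $(a-b)/p^2$ is a rational number with denominator prime to $p$. *)

(* Defs.v *)
From HB Require Import structures.
From mathcomp Require Import all_boot all_order all_fingroup all_algebra.

Set Implicit Arguments.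
Unset Strict Implicit.
Unset Printing Implicit Defensive.

Import GRing.Theory.
Local Open Scope ring_scope.

Definition per (R : comNzRingType) (n : nat) (A : 'M[R]_n) : R :=
  \sum_(s : 'S_n) \prod_(i < n) A i (s i).

(* The values [0], [1], [-1] are those of the Legendre symbol when [p] is an
   odd prime; for other [p] this is not the Jacobi symbol. *)
Definition legendre (d : int) (p : nat) : int :=
  if (p%:Z %| d)%Z then 0
  else if [exists x : 'I_p, ((x%:Z ^+ 2)%R == d %[mod p%:Z])%Z] then 1
  else -1.

(* Congruence modulo [p ^ e] of rational numbers in the ring of [p]-integral
   rationals. *)
Definition eqmod_pint (p e : nat) (a b : rat) : Prop :=
  coprime p `|denq ((a - b) / (p%:R ^+ e))|%N.

(* Main.v *)
Require Import Defs.
From mathcomp Require Import all_boot all_order all_fingroup all_algebra.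
From mathcomp Require Import finfield zify ring.

Set Implicit Arguments.
Unset Strict Implicit.
Unset Printing Implicit Defensive.

Import GRing.Theory Num.Theory.
Local Open Scope ring_scope.

(** Every matrix in the theorem has entries [a_j + b_j x_k], an affine function
    of a column variable. Expanding each product in its permanent over the set
    [S] of rows where the [b]-term is chosen, and summing over the permutations
    first, the set [S] contributes the sum of [\prod_(j in S) x (s j)] over all
    [s]; each set [T] with [#|T| = #|S| = r] is the image of [S] under exactly
    [r! (n-r)!] permutations, so this is [r! (n-r)! e_r(x)] ([sum_perm_prod]).
    Hence, with [e_r] the elementary symmetric functions,
      per[1 + y_j x_k] = \sum_r r! (n-r)! e_r(y) e_r(x),
      per[y_j + x_k] = \sum_r r! (n-r)! e_(n-r)(y) e_r(x)
    ([per_one_add_outer], [per_add_outer]), and what remains is to know the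
    [e_r].

    Over a field, if [x_1, ..., x_n] are [n] distinct [n]-th roots of unity then
    [\prod_i (X - x_i) = X^n - 1], so [e_r(-x)] vanishes for [0 < r < n]. This
    gives the two identities for roots of unity, the second one by dividing
    [X^n - 1] by [X - 1].

    Modulo a prime [p = 2 h + 1] the same fact applies to [1, ..., p-1], which
    are [(p-1)]-th roots of unity by Fermat's little theorem, and to
    [1^2, ..., h^2], which are [h]-th roots of unity. In [per[y_j + d y_k]] the
    [r]-th term is [r! (n-r)! d^r e_(n-r)(y) e_r(y)], a product of two
    elementary symmetric functions. Away from the ends both are divisible by
    [p], and the product by [p^2]: only the end terms survive
    ([per_scaled_mod_sqr]). When the entry 0 or [p] is added to the family the
    end terms vanish as well, and the next ones, [r = 1] and [r = n-1], carry the
    value ([per_scaled_mod_sqr_S]); they involve [e_1], a sum that is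
    computed exactly and is divisible by [p]. What is left is Wilson's theorem,
    Fermat's little theorem and, for the squares, Euler's criterion. *)

(** * Permutations carrying one set onto another *)

Lemma card_set_ord n (S : {set 'I_n}) : (#|S| <= n)%N.
Proof. by rewrite -[n in (_ <= n)%N]card_ord max_card. Qed.

(** The witness lists [S] first and its complement afterwards. *)
Lemma perm_initial_segment n (S : {set 'I_n}) :
  exists s : 'S_n, forall i, (s i \in S) = (i < #|S|)%N.
Proof.
pose l := enum S ++ enum (~: S).
have size_l : size l = n by rewrite size_cat -!cardE cardsC card_ord.
have /tuple_permP[s l_eq] : perm_eq l (ord_tuple n).
  apply: uniq_perm.
  - rewrite cat_uniq !enum_uniq andbT /=.
    by apply/hasPn=> i; rewrite !mem_enum inE.
  - exact: enum_uniq.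
  - by move=> i; rewrite mem_cat !mem_enum inE orbN.
exists s => i.
have -> : s i = nth i l i.
  by rewrite l_eq -tnth_nth tnth_mktuple tnth_ord_tuple.
rewrite /l nth_cat -cardE; case: ltnP => i_S.
  by rewrite -mem_enum mem_nth // -cardE.
apply/negbTE; rewrite -in_setC -mem_enum mem_nth //.
by rewrite -(ltn_add2l (size (enum S))) -size_cat -/l size_l -cardE subnKC.
Qed.

Lemma perm_imset_exists n (S T : {set 'I_n}) :
  #|S| = #|T| -> exists t : 'S_n, t @: S = T.
Proof.
move=> eqST; have [s sP] := perm_initial_segment S.
have [t tP] := perm_initial_segment T.
exists (s^-1 * t)%g; apply/eqP.
rewrite eqEcard card_imset ?eqST ?leqnn ?andbT; last exact: perm_inj.
by apply/subsetP=> _ /imsetP[i Si ->]; rewrite permM tP -eqST -sP permKV.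
Qed.

(** Double counting: composing with a permutation that carries [U] onto [T]
    shows that the number of [s] with [s @: S = U] is the same for all the
    ['C(n, #|S|)] sets [U] of the cardinality of [S], and these numbers add up to
    [n!]. *)
Lemma card_perm_imset n (S T : {set 'I_n}) : #|S| = #|T| ->
  #|[set s : 'S_n | s @: S == T]| = (#|S|`! * (n - #|S|)`!)%N.
Proof.
move=> eqST; pose N (U : {set 'I_n}) := #|[set s : 'S_n | s @: S == U]|.
have leSn := card_set_ord S.
have N_const (U : {set 'I_n}) : #|U| == #|S| -> N U = N T.
  move=> /eqP eqUS; have [t tUT] : exists t : 'S_n, t @: U = T.
    by apply: perm_imset_exists; rewrite eqUS.
  rewrite /N -(card_imset _ (mulIg t)); apply: eq_card => s; rewrite inE.
  apply/imsetP/eqP=> [[u]|sST].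
    rewrite inE => /eqP uSU ->; rewrite -tUT -uSU -imset_comp.
    by apply: eq_imset => i; rewrite permM.
  exists (s * t^-1)%g; last by rewrite mulgKV.
  rewrite inE; apply/eqP/(imset_inj (@perm_inj _ t)); rewrite tUT -sST.
  by rewrite -imset_comp; apply: eq_imset => i; rewrite /= permM permKV.
apply/eqP; rewrite -(eqn_pmul2l (m := 'C(n, #|S|))) ?bin_gt0 // bin_fact //.
have <- : (\sum_(U : {set 'I_n} | #|U| == #|S|) N U = n`!)%N.
  transitivity #|{: 'S_n}|; last by rewrite card_Sn.
  rewrite -[RHS]sum1_card [RHS](partition_big (fun s : 'S_n => s @: S)
    (fun U : {set 'I_n} => #|U| == #|S|)) /=; last first.
    by move=> s _; rewrite card_imset //; exact: perm_inj.
  apply: eq_bigr => U _; rewrite /N -[LHS]sum1_card.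
  by apply: eq_bigl => s; rewrite inE.
rewrite (eq_bigr (fun=> N T)) // sum_nat_cond_const -[n in 'C(n, _)]card_ord.
by rewrite card_draws.
Qed.

(** * Elementary symmetric functions and permanents *)

Definition elem_sym (R : comNzRingType) n (x : 'I_n -> R) (r : nat) : R :=
  \sum_(S : {set 'I_n} | #|S| == r) \prod_(i in S) x i.

Section ElementarySymmetric.
Variables (R : comNzRingType) (n : nat).
Implicit Types x y : 'I_n -> R.

Lemma eq_elem_sym x y r : x =1 y -> elem_sym x r = elem_sym y r.
Proof.
by move=> xy; apply: eq_bigr => S _; apply: eq_bigr => i _; rewrite xy.
Qed.

Lemma elem_sym0 x : elem_sym x 0 = 1.
Proof.
rewrite /elem_sym (big_pred1 set0) => [|S]; first by rewrite big_set0.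
by rewrite cards_eq0.
Qed.

Lemma elem_sym_all x : elem_sym x n = \prod_i x i.
Proof.
rewrite /elem_sym (big_pred1 setT) => [|S].
  by apply: eq_bigl => i; rewrite inE.
by rewrite /= eqEcard subsetT cardsT card_ord eqn_leq card_set_ord.
Qed.

Lemma elem_sym1 x : elem_sym x 1 = \sum_i x i.
Proof.
rewrite /elem_sym (eq_bigl (fun S => S \in [set [set i] | i : 'I_n])) => [|S].
  rewrite big_imset /= => [|i j _ _]; last exact: set1_inj.
  by apply: eq_bigr => i _; rewrite big_set1.
by apply/cards1P/imsetP=> [[i ->]|[i _ ->]]; exists i.
Qed.

Lemma elem_symZ c x r : elem_sym (fun i => c * x i) r = c ^+ r * elem_sym x r.
Proof.
rewrite /elem_sym big_distrr; apply: eq_bigr => S /eqP <-.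
by rewrite big_split /= prodr_const.
Qed.

(** Vieta's formula: the way in which factorisations of polynomials are turned
    into values of elementary symmetric functions. *)
Lemma coef_prod_XaddC x r : (r <= n)%N ->
  (\prod_i ('X + (x i)%:P))`_(n - r) = elem_sym x r.
Proof.
move=> le_rn; rewrite bigA_distr coef_sum [RHS]big_mkcond.
rewrite (reindex_inj (@setC_inj _)) /=.
apply: eq_bigr => S _.
have -> : \prod_i (if i \in ~: S then 'X else (x i)%:P)
   = (\prod_(i in S) x i)%:P * 'X^(n - #|S|).
  rewrite (bigID (mem S)) /= rmorph_prod; congr (_ * _).
    by apply: eq_bigr => i; rewrite inE => ->.
  rewrite (eq_bigr (fun=> 'X)) => [|i /negbTE iS]; last by rewrite inE iS.
  rewrite (eq_bigl (fun i => i \in ~: S)); last by move=> i; rewrite inE.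
  by rewrite prodr_const cardsCs setCK card_ord.
rewrite coefCM coefXn; have leSn := card_set_ord S.
have -> : (n - r == n - #|S|)%N = (#|S| == r).
  by apply/eqP/eqP=> [eq_sub|->//]; rewrite -(subKn leSn) -eq_sub subKn.
by case: eqP => _; rewrite (mulr1, mulr0).
Qed.

(** The product only depends on the image of [S] under [s], which makes the
    count of [card_perm_imset] the multiplicity of each monomial. *)
Lemma sum_perm_prod x (S : {set 'I_n}) :
  \sum_(s : 'S_n) \prod_(j in S) x (s j)
    = (#|S|`! * (n - #|S|)`!)%:R * elem_sym x #|S|.
Proof.
rewrite (partition_big (fun s : 'S_n => s @: S)
  (fun T : {set 'I_n} => #|T| == #|S|)) /=; last first.
  by move=> s _; rewrite card_imset //; exact: perm_inj.
rewrite /elem_sym big_distrr /=; apply: eq_bigr => T /eqP eqTS.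
rewrite -(card_perm_imset (esym eqTS)) mulr_natl -sumr_const /=.
apply: eq_big => [s|s /eqP <-]; first by rewrite inE.
by rewrite big_imset //= => i j _ _ /perm_inj.
Qed.

(** [S] is the set of rows in which the term [b j * x k] is picked. *)
Lemma per_outer x (a b : 'I_n -> R) :
  per (\matrix_(j < n, k < n) (a j + b j * x k))
    = \sum_(S : {set 'I_n}) (\prod_(j in S) b j) * (\prod_(j in ~: S) a j)
        * ((#|S|`! * (n - #|S|)`!)%:R * elem_sym x #|S|).
Proof.
rewrite /per; under [RHS]eq_bigr do rewrite -sum_perm_prod big_distrr /=.
rewrite exchange_big /=; apply: eq_bigr => s _.
under eq_bigr do rewrite mxE addrC.
rewrite bigA_distr; apply: eq_bigr => S _.
rewrite (bigID (mem S)) /= mulrAC -big_split /=; congr (_ * _).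
  by apply: eq_bigr => i ->.
by apply: eq_big => [i|i /negbTE ->//]; rewrite inE.
Qed.

Lemma per_one_add_outer x y :
  per (\matrix_(j < n, k < n) (1 + y j * x k))
    = \sum_(0 <= r < n.+1) (r`! * (n - r)`!)%:R * elem_sym y r * elem_sym x r.
Proof.
rewrite per_outer big_mkord.
rewrite (partition_big (fun S : {set 'I_n} => inord #|S| : 'I_n.+1) predT) //=.
apply: eq_bigr => r _; rewrite mulrAC [elem_sym y r]/elem_sym big_distrr /=.
apply: eq_big => [S|S /eqP <-].
  by rewrite -val_eqE /= inordK // ltnS card_set_ord.
by rewrite inordK ?ltnS ?card_set_ord // big1_eq mulr1 mulrC.
Qed.

(** As [b] is constantly 1, the coefficient attached to [S] in [per_outer] is
    the product of [y] over the complement of [S], whence the index [n - r]. *)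
Lemma per_add_outer x y :
  per (\matrix_(j < n, k < n) (y j + x k))
    = \sum_(0 <= r < n.+1)
        (r`! * (n - r)`!)%:R * elem_sym y (n - r) * elem_sym x r.
Proof.
transitivity (per (\matrix_(j < n, k < n) (y j + 1 * x k))).
  by congr per; apply/matrixP=> j k; rewrite !mxE mul1r.
rewrite per_outer big_mkord.
rewrite (partition_big (fun S : {set 'I_n} => inord #|S| : 'I_n.+1) predT) //=.
apply: eq_bigr => r _; rewrite mulrAC [elem_sym y _]/elem_sym big_distrr /=.
(* The monomials of degree [n - r] in [y] are indexed by complements. *)
rewrite [RHS](reindex_inj (@setC_inj _)) /=.
have le_rn : (r <= n)%N by rewrite -ltnS.
apply: eq_big => [S|S /eqP <-].
  rewrite -val_eqE /= inordK ?ltnS ?card_set_ord //.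
  rewrite [#|~: S|]cardsCs setCK card_ord.
  apply/eqP/eqP=> [->//|eq_sub].
  by rewrite -(subKn (card_set_ord S)) eq_sub subKn.
rewrite inordK ?ltnS ?card_set_ord // big1_eq mul1r.
by rewrite mulrC.
Qed.
End ElementarySymmetric.

Lemma sum_ends (V : nmodType) n (f : nat -> V) : (0 < n)%N ->
  \sum_(0 <= r < n.+1) f r = f 0%N + f n + \sum_(1 <= r < n) f r.
Proof.
by case: n => // n _; rewrite big_ltn // big_nat_recr //= addrAC addrA.
Qed.

Lemma elem_sym_morph (R S : comNzRingType) (f : {rmorphism R -> S}) n
    (x : 'I_n -> R) r :
  f (elem_sym x r) = elem_sym (fun i => f (x i)) r.
Proof. by rewrite rmorph_sum; apply: eq_bigr => T _; rewrite rmorph_prod. Qed.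

Lemma elem_sym_drop0 (R : comNzRingType) n (x : 'I_n.+1 -> R) k r :
  x k = 0 -> (r <= n)%N -> elem_sym x r = elem_sym (fun i => x (lift k i)) r.
Proof.
move=> xk0 le_rn; rewrite -!coef_prod_XaddC // ?(leq_trans le_rn) //.
by rewrite (bigD1_ord k) //= xk0 polyC0 addr0 mulrC subSn // coefMX.
Qed.

(** * Permanents built on roots of unity *)

Section RootsOfUnity.
Variables (F : fieldType) (n : nat) (x : 'I_n -> F).
Hypotheses (n_gt0 : (0 < n)%N) (x_inj : injective x).
Hypothesis xn1 : forall i, x i ^+ n = 1.

Lemma prod_XsubC_roots_unity : \prod_i ('X - (x i)%:P) = 'X^n - 1.
Proof.
rewrite -(big_image _ _ _ _ (fun z => 'X - z%:P)) /=.
have lead1 : lead_coef ('X^n - 1 : {poly F}) = 1.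
  by rewrite lead_coefDl ?lead_coefXn // size_polyXn size_polyN size_poly1.
rewrite [RHS](@all_roots_prod_XsubC _ _ [seq x i | i : 'I_n])
  ?lead1 ?scale1r //.
- by rewrite size_image card_ord size_XnsubC.
- apply/allP=> _ /imageP[i _ ->].
  by rewrite rootE !hornerE xn1 subrr.
- by rewrite uniq_rootsE map_inj_uniq ?enum_uniq.
Qed.

(** These are the coefficients of ['X^n - 1]; the sign on [x] absorbs the
    alternating sign of Vieta's formula. *)
Lemma elem_sym_roots_unity r : (r <= n)%N ->
  elem_sym (fun i => - x i) r = (r == 0%N)%:R - (r == n)%:R.
Proof.
move=> le_rn; rewrite -coef_prod_XaddC //.
under eq_bigr do rewrite polyCN.
rewrite prod_XsubC_roots_unity coefB coefXn coef1 subn_eq0.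
congr ((nat_of_bool _)%:R - (nat_of_bool _)%:R); first by apply/eqP/eqP; lia.
by rewrite [RHS]eqn_leq le_rn.
Qed.
End RootsOfUnity.

Section PrimitiveRoot.
Variables (F : fieldType) (n : nat) (zeta : F).
Hypothesis zeta_prim : n.-primitive_root zeta.

Let n_gt0 : (0 < n)%N := prim_order_gt0 zeta_prim.

Lemma prim_root_inj : injective (fun i : 'I_n => zeta ^+ i.+1).
Proof.
move=> i j /eqP; rewrite (eq_prim_root_expr zeta_prim).
rewrite -addn1 -(addn1 j) eqn_modDr !modn_small // => /eqP; exact: val_inj.
Qed.

Lemma elem_sym_prim_root r : (r <= n)%N ->
  elem_sym (fun i : 'I_n => - zeta ^+ i.+1) r = (r == 0%N)%:R - (r == n)%:R.
Proof.
apply: elem_sym_roots_unity => // [|i]; first exact: prim_root_inj.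
by rewrite exprAC (prim_expr_order zeta_prim) expr1n.
Qed.

Lemma per_prim_root (x : 'I_n -> F) :
  per (\matrix_(j < n, k < n) (1 - zeta ^+ j.+1 * x k))
    = n`!%:R * (1 - \prod_(k < n) x k).
Proof.
transitivity (per (\matrix_(j < n, k < n) (1 + (- zeta ^+ j.+1) * x k))).
  by congr per; apply/matrixP=> j k; rewrite !mxE mulNr.
rewrite per_one_add_outer sum_ends //= big_nat big1 => [|r /andP[r_gt0 lt_rn]].
  rewrite !elem_sym_prim_root // elem_sym0 elem_sym_all eqxx subn0 subnn.
  rewrite fact0 mul1n muln1 [0%N == n]eq_sym gtn_eqF // eqxx /=; ring.
rewrite elem_sym_prim_root 1?ltnW // gtn_eqF // ltn_eqF // subrr.
by rewrite mulr0 mul0r.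
Qed.
End PrimitiveRoot.

(** Leaving out the root [1 = zeta ^+ n.+1] leaves the polynomial
    [('X^(n+1) - 1) / ('X - 1) = 1 + 'X + ... + 'X^n]. *)
Lemma elem_sym_prim_root_pred (F : fieldType) n (zeta : F) r :
  n.+1.-primitive_root zeta -> (r <= n)%N ->
  elem_sym (fun i : 'I_n => - zeta ^+ i.+1) r = 1.
Proof.
move=> zeta_prim le_rn; rewrite -coef_prod_XaddC //.
suff -> : \prod_(i < n) ('X + (- zeta ^+ i.+1)%:P) = \poly_(i < n.+1) 1.
  by rewrite coef_poly ltnS leq_subr.
apply: (mulfI (negbT (polyXsubC_eq0 1))).
rewrite poly_def; under [X in _ = _ * X]eq_bigr do rewrite scale1r.
rewrite polyC1 -subrX1.
have xn1 (i : 'I_n.+1) : (zeta ^+ i.+1) ^+ n.+1 = 1.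
  by rewrite exprAC (prim_expr_order zeta_prim) expr1n.
rewrite -(prod_XsubC_roots_unity _ (prim_root_inj zeta_prim) xn1) //.
rewrite big_ord_recr /= (prim_expr_order zeta_prim) mulrC.
by under eq_bigr do rewrite polyCN.
Qed.

(** The factor [zeta ^+ (j + k)] splits as a product of a row and a column
    factor; the weight [r! (n - r)!] of [per_one_add_outer] is the quotient
    [n! / 'C(n, r)]. *)
Lemma per_prim_root_pred (F : fieldType) n (zeta x : F) :
  n.+1.-primitive_root zeta ->
  per (\matrix_(j < n, k < n) (1 + zeta ^+ (j.+1 + k.+1) * x))
    = \sum_(0 <= k < n.+1) (n`! %/ 'C(n, k))%:R * x ^+ k.
Proof.
move=> zeta_prim.
(* The two minus signs cancel and make every [e_r] below equal to 1. *)
transitivity (per (\matrix_(j < n, k < n)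
    (1 + (- zeta ^+ j.+1) * (x * - zeta ^+ k.+1)))).
  by congr per; apply/matrixP=> j k; rewrite !mxE exprD; ring.
rewrite per_one_add_outer; apply: eq_big_nat => r /andP[_ lt_rn].
rewrite elem_symZ !(elem_sym_prim_root_pred zeta_prim) // !mulr1.
by rewrite -(bin_fact (lt_rn : (r <= n)%N)) mulKn ?bin_gt0.
Qed.

(** * Permanents of [y_j + d y_k] modulo a square *)

Lemma dvdz_sqr_term (q c d : int) n (y : 'I_n -> int) r s :
  (q %| elem_sym y s)%Z -> (q %| elem_sym y r)%Z ->
  (q ^+ 2 %| c * elem_sym y s * elem_sym (fun i => (d * y i)%R) r)%Z.
Proof.
move=> q_s q_r; rewrite elem_symZ -mulrA [elem_sym y s * _]mulrCA.
by rewrite expr2; do 2!apply: dvdz_mull; apply: dvdz_mul.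
Qed.

(** Only the terms [r = 0] and [r = n] survive, since in all others both
    elementary symmetric functions are divisible by [q]. *)
Lemma per_scaled_mod_sqr (q d : int) n (y : 'I_n -> int) : (0 < n)%N ->
  (forall r, (0 < r < n)%N -> (q %| elem_sym y r)%Z) ->
  (q ^+ 2 %| per (\matrix_(j < n, k < n) (y j + d * y k))
             - n`!%:Z * elem_sym y n * (1 + d ^+ n))%Z.
Proof.
move=> n_gt0 q_dvd.
rewrite per_add_outer sum_ends // !elem_symZ subn0 subnn fact0.
rewrite mul1n muln1 !elem_sym0.
rewrite [X in (_ %| X)%Z](_ : _ = \sum_(1 <= r < n) (r`! * (n - r)`!)%:R *
   elem_sym y (n - r) * elem_sym (fun i => d * y i) r).
  rewrite big_nat; apply: rpred_sum => r r_bnd.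
  by apply: dvdz_sqr_term; apply: q_dvd; lia.
by rewrite !natz; ring.
Qed.

(** This is for [n] roots of unity modulo [q] completed by one more entry, which
    is either 0 or a multiple of [q] with [q] dividing [(n+1)!]. The last
    hypothesis discards the terms [r = 0] and [r = n.+1], so [r = 1] and [r = n]
    give the value; they are two different terms because [1 < n]. *)
Lemma per_scaled_mod_sqr_S (q d : int) n (y : 'I_n.+1 -> int) : (1 < n)%N ->
  (forall r, (0 < r < n)%N -> (q %| elem_sym y r)%Z) ->
  (q ^+ 2 %| n.+1`!%:Z * elem_sym y n.+1)%Z ->
  (q ^+ 2 %| per (\matrix_(j < n.+1, k < n.+1) (y j + d * y k))
             - n`!%:Z * elem_sym y 1 * elem_sym y n * (d + d ^+ n))%Z.
Proof.
move=> n_gt1 q_dvd q_dvd_last; have n_gt0 := ltnW n_gt1.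
have main_terms : \sum_(1 <= r < n.+1) (r`! * (n.+1 - r)`!)%:R
      * elem_sym y (n.+1 - r) * elem_sym (fun i => d * y i) r
    = n`!%:Z * elem_sym y 1 * elem_sym y n * (d + d ^+ n)
      + \sum_(2 <= r < n) (r`! * (n.+1 - r)`!)%:R
        * elem_sym y (n.+1 - r) * elem_sym (fun i => d * y i) r.
  rewrite big_ltn // big_nat_recr //= !elem_symZ subSnn subSS subn0.
  by rewrite mul1n muln1 !natz; ring.
rewrite per_add_outer sum_ends // main_terms !elem_symZ subn0 subnn fact0.
rewrite mul1n muln1 !elem_sym0 !natz.
set last := _ * elem_sym y n.+1; set main := n`!%:Z * _ * _ * _.
set mid := \sum_(_ <= _ < _) _.
rewrite (_ : _ - main = last * (1 + d ^+ n.+1) + mid); last first.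
  by rewrite /last; ring.
apply: rpredD; first exact: dvdz_mulr.
rewrite /mid big_nat; apply: rpred_sum => r r_bnd.
by apply: dvdz_sqr_term; apply: q_dvd; lia.
Qed.

(** Clears a denominator prime to [p], which reduces the congruences between
    rationals to divisibility in [int]. *)
Lemma eqmod_pint_div (p e m : nat) (a b : int) : prime p -> coprime p m ->
  (p%:Z ^+ e %| m%:Z * a - b)%Z -> eqmod_pint p e a%:~R (b%:~R / m%:R).
Proof.
move=> p_pr p_m /dvdzP[c c_eq]; rewrite /eqmod_pint.
have m_neq0 : (m%:R : rat) != 0.
  rewrite pnatr_eq0; apply: contraTneq p_m => ->.
  by rewrite /coprime gcdn0 gtn_eqF ?prime_gt1.
have pe_neq0 : (p%:R ^+ e : rat) != 0.
  by rewrite expf_neq0 // pnatr_eq0 -lt0n prime_gt0.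
set x := (_ / _); have /eqP x_eq : x = c%:~R / m%:R.
  rewrite /x; apply: (mulIf pe_neq0); apply: (mulIf m_neq0).
  rewrite divfK // mulrBl divfK // mulrAC divfK //.
  have := congr1 (fun z : int => z%:~R : rat) c_eq.
  by rewrite !rmorphB !rmorphM rmorphXn /= -!pmulrn => <-; ring.
(* [numq x * m = c * denq x] with [numq x] and [denq x] coprime, so [denq x]
   divides [m]. *)
apply: coprime_dvdr p_m.
rewrite -(Gauss_dvdr (n := `|numq x|)); last first.
  by rewrite coprime_sym coprime_num_den.
move: x_eq; rewrite -{1}(divq_num_den x) eqr_div ?intr_eq0 ?denq_neq0 //.
rewrite pmulrn -!rmorphM /= eqr_int => /eqP numq_m.
by have := dvdz_mull c (dvdzz (denq x)); rewrite -numq_m dvdzE abszM.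
Qed.

Lemma sum_succ n : 2 * (\sum_(i < n) i.+1%:Z) = n%:Z * n.+1%:Z.
Proof.
elim: n => [|n IHn]; first by rewrite big_ord0.
rewrite big_ord_recr /= mulrDr IHn !intS; ring.
Qed.

Lemma sum_succ_sqr n :
  6 * (\sum_(i < n) i.+1%:Z ^+ 2) = n%:Z * n.+1%:Z * n.*2.+1%:Z.
Proof.
elim: n => [|n IHn]; first by rewrite big_ord0.
rewrite big_ord_recr /= mulrDr IHn doubleS !intS -muln2 PoszM; ring.
Qed.

Lemma prod_succ_fact n : \prod_(i < n) i.+1%:Z = n`!%:Z.
Proof.
rewrite fact_prod big_add1 /= big_mkord -natz natr_prod.
by under [RHS]eq_bigr do rewrite natz.
Qed.

(** * Roots of unity in the prime field *)

Section ModPrime.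
Variable m : nat.
Local Notation p := m.+1.
Hypothesis p_pr : prime p.

Lemma dvdz_Fp (a : int) : (p%:Z %| a)%Z = (a%:~R == 0 :> 'F_p).
Proof. exact: (dvdz_pcharf (pchar_Fp p_pr)). Qed.

Lemma intr_Fp_neq0 (k : nat) : (0 < k < p)%N -> k%:~R != 0 :> 'F_p.
Proof. by case/andP=> k0 kp; rewrite -dvdz_Fp dvdzE /= gtnNdvd. Qed.

Lemma fermat_Fp (a : 'F_p) : a != 0 -> a ^+ m = 1.
Proof.
move=> a0; apply: (mulfI a0).
by rewrite -exprS mulr1 -[X in a ^+ X](card_Fp p_pr) expf_card.
Qed.

Lemma intr_Fp_inj (i j : nat) : (i < p)%N -> (j < p)%N ->
  i%:~R = j%:~R :> 'F_p -> i = j.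
Proof.
move=> ip jp /(congr1 val); rewrite /= -!pmulrn !val_Fp_nat // !modn_small //.
Qed.

Lemma elem_sym_Fp_roots n (y : 'I_n -> int) r : (0 < n)%N ->
  injective (fun i => (y i)%:~R : 'F_p) ->
  (forall i, (y i)%:~R ^+ n = 1 :> 'F_p) -> (r <= n)%N ->
  (elem_sym y r)%:~R = (-1) ^+ r * ((r == 0%N)%:R - (r == n)%:R) :> 'F_p.
Proof.
move=> n_gt0 y_inj y_roots le_rn.
rewrite -(elem_sym_roots_unity n_gt0 y_inj y_roots le_rn) -elem_symZ.
by rewrite elem_sym_morph; apply: eq_elem_sym => i; rewrite mulrNN mul1r.
Qed.

Lemma dvdz_elem_sym_Fp_roots n (y : 'I_n -> int) r :
  injective (fun i => (y i)%:~R : 'F_p) ->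
  (forall i, (y i)%:~R ^+ n = 1 :> 'F_p) -> (0 < r < n)%N ->
  (p%:Z %| elem_sym y r)%Z.
Proof.
move=> y_inj y_roots /andP[r_gt0 lt_rn]; have n_gt0 := ltn_trans r_gt0 lt_rn.
rewrite dvdz_Fp elem_sym_Fp_roots ?(ltnW lt_rn) // gtn_eqF // ltn_eqF //.
by rewrite subrr mulr0.
Qed.

(** The constant coefficient of ['X^n - 1]. *)
Lemma prod_Fp_roots n (y : 'I_n -> int) : (0 < n)%N ->
  injective (fun i => (y i)%:~R : 'F_p) ->
  (forall i, (y i)%:~R ^+ n = 1 :> 'F_p) ->
  (p%:Z %| \prod_i y i + (-1) ^+ n)%Z.
Proof.
move=> n_gt0 y_inj y_roots.
rewrite dvdz_Fp -elem_sym_all rmorphD /= elem_sym_Fp_roots // eqxx gtn_eqF //.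
by rewrite rmorphXn /= rmorphN1 sub0r mulrN1 addNr.
Qed.

Lemma units_Fp_inj : injective (fun i : 'I_m => (i.+1%:Z)%:~R : 'F_p).
Proof.
by move=> i j /intr_Fp_inj-/(_ (ltn_ord i) (ltn_ord j)) [] /val_inj.
Qed.

Lemma units_Fp_roots (i : 'I_m) : (i.+1%:Z)%:~R ^+ m = 1 :> 'F_p.
Proof. by apply/fermat_Fp/intr_Fp_neq0; have := ltn_ord i; lia. Qed.

Lemma prime_pred_gt0 : (0 < m)%N.
Proof. by rewrite -ltnS prime_gt1. Qed.

(** * Permanents of residues modulo a prime *)

Lemma wilson : (p%:Z %| m`!%:Z + 1)%Z.
Proof.
by rewrite -PoszD addn1 dvdzE /= -[m in m`!]/(p.-1) -Wilson ?prime_gt1.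
Qed.

(** With [W = (p-1)!] and [P] the product of the [x k], the two end terms add up
    to [W^2 + W P], and [W^2 + W P - (1 - P) = (W + 1) (W - 1 + P)] is divisible
    by [p] by Wilson's theorem. *)
Lemma per_add_units_mod (x : 'I_m -> int) :
  (p%:Z %| per (\matrix_(j < m, k < m) (j.+1%:Z + x k))
           - (1 - \prod_(k < m) x k))%Z.
Proof.
rewrite per_add_outer sum_ends ?prime_pred_gt0 // subn0 subnn fact0.
rewrite mul1n muln1 !elem_sym0 !elem_sym_all prod_succ_fact !natz.
rewrite (_ : _ - _ = (m`!%:Z + 1) * (m`!%:Z - 1 + \prod_k x k)
    + \sum_(1 <= r < m) (r`! * (m - r)`!)%:R
       * elem_sym (fun i : 'I_m => i.+1%:Z) (m - r)
       * elem_sym x r); last by ring.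
apply: rpredD; first by apply/dvdz_mulr/wilson.
rewrite big_nat; apply: rpred_sum => r r_bnd; apply/dvdz_mulr/dvdz_mull.
by apply: dvdz_elem_sym_Fp_roots units_Fp_inj units_Fp_roots _; lia.
Qed.

Lemma fermat_int (d : int) : ~~ (p%:Z %| d)%Z -> (p%:Z %| d ^+ m - 1)%Z.
Proof.
by rewrite !dvdz_Fp => /fermat_Fp dm; rewrite rmorphB rmorphXn /= dm subrr.
Qed.

(** The end terms give [W^2 (1 + d^(p-1))] with [W = (p-1)!]. As [W = -1] and
    [d^(p-1) = 1] modulo [p], modulo [p^2] one has [W^2 = -1 - 2 W], and
    [(W + 1) d^(p-1) = W + 1]; this is how [W^2] becomes the linear term
    [-4 W]. *)
Lemma per_scaled_units (d : int) : ~~ (p%:Z %| d)%Z ->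
  (p%:Z ^+ 2 %| per (\matrix_(j < m, k < m) (j.+1%:Z + d * k.+1%:Z))
     - (d ^+ m - 3 - 4 * m`!%:Z))%Z.
Proof.
move=> /fermat_int /dvdzP[q dm]; have /dvdzP[w m_fact] := wilson.
have /dvdzP[c] := @per_scaled_mod_sqr p d m (fun i => i.+1%:Z) prime_pred_gt0
  (fun r => @dvdz_elem_sym_Fp_roots _ _ r units_Fp_inj units_Fp_roots).
rewrite elem_sym_all prod_succ_fact => /eqP; rewrite subr_eq => /eqP ->.
have -> : d ^+ m = q * p%:Z + 1 by rewrite -dm subrK.
have -> : m`!%:Z = w * p%:Z - 1 by rewrite -m_fact addrK.
apply/dvdzP; exists (c + 2 * w ^+ 2 + q * w ^+ 2 * p%:Z - 2 * q * w); ring.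
Qed.

(** One entry [y k] is divisible by [p] and the others are [1, ..., p-1] modulo
    [p]; [s] is 1 for [1, ..., p] and -1 for [0, ..., p-1]. The
    permanent is [(p-1)! e_1 e_(p-1) (d + d^(p-1))] modulo [p^2]. As [p] divides
    [e_1], the other factors only matter modulo [p], where they are [-1], [-1]
    and [d + 1]; and [2 e_1 = p (p + s)]. *)
Lemma per_scaled_residues (y : 'I_p -> int) k (s d : int) : odd p ->
  (p%:Z %| y k)%Z -> (forall i : 'I_m, (p%:Z %| y (lift k i) - i.+1%:Z)%Z) ->
  2 * \sum_i y i = p%:Z * (p%:Z + s) -> ~~ (p%:Z %| d)%Z ->
  (p%:Z ^+ 2 %| 2 * per (\matrix_(j < p, k < p) (y j + d * y k))
      - s * (d + 1) * p%:Z)%Z.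
Proof.
move=> p_odd y_k y_lift y_sum p_d.
have m_gt1 : (1 < m)%N by move: p_odd prime_pred_gt0; case: (m) => [|[]].
have e_units r : (r <= m)%N ->
    (elem_sym y r)%:~R = (elem_sym (fun i : 'I_m => i.+1%:Z) r)%:~R :> 'F_p.
  move=> le_rm; rewrite !elem_sym_morph (@elem_sym_drop0 _ _ _ k) //.
    apply: eq_elem_sym => i; apply/eqP.
    by rewrite -subr_eq0 -rmorphB -dvdz_Fp.
  by apply/eqP; rewrite -dvdz_Fp.
have e_mid r : (0 < r < m)%N -> (p%:Z %| elem_sym y r)%Z.
  move=> r_bnd; rewrite dvdz_Fp e_units; last by lia.
  rewrite -dvdz_Fp.
  exact: dvdz_elem_sym_Fp_roots units_Fp_inj units_Fp_roots _.
have e_last : (p%:Z ^+ 2 %| p`!%:Z * elem_sym y p)%Z.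
  rewrite elem_sym_all (bigD1 k) //= expr2.
  by apply: dvdz_mul; [rewrite factS PoszM|]; apply: dvdz_mulr.
have /dvdzP[v e_m] : (p%:Z %| elem_sym y m + 1)%Z.
  rewrite dvdz_Fp rmorphD /= e_units // elem_sym_all prod_succ_fact.
  by rewrite -rmorphD -dvdz_Fp; exact: wilson.
have /dvdzP[q dm] := fermat_int p_d; have /dvdzP[w m_fact] := wilson.
(* Below, [w], [v] and [q] are the quotients by [p] in the congruences
   [m! = -1], [e_m = -1] and [d ^+ m = 1]. *)
have /dvdzP[c /eqP] := per_scaled_mod_sqr_S d m_gt1 e_mid e_last.
rewrite subr_eq => /eqP ->; rewrite mulrDr -!mulrA 3![2 * _]mulrCA !mulrA.
rewrite -[_ * 2 * elem_sym y 1]mulrA elem_sym1 y_sum.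
have -> : elem_sym y m = v * p%:Z - 1 by rewrite -e_m addrK.
have -> : d ^+ m = q * p%:Z + 1 by rewrite -dm subrK.
have -> : m`!%:Z = w * p%:Z - 1 by rewrite -m_fact addrK.
(* [1 + t p] is the product of [m!] and [e_m]. *)
pose t := w * v * p%:Z - w - v.
apply/dvdzP; exists (2 * c + d + 1 + q * (p%:Z + s)
  + t * (p%:Z + s) * (d + 1 + q * p%:Z)).
rewrite /t; ring.
Qed.

End ModPrime.

(** * Permanents of squares modulo a prime *)

Section Squares.
Variable h : nat.
Local Notation p := h.*2.+1.
Hypothesis p_pr : prime p.

Let h_gt0 : (0 < h)%N.
Proof. by rewrite -double_gt0; exact: prime_pred_gt0 p_pr. Qed.

(** If two of these squares agree modulo [p] then [p] divides [i - j] or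
    [i + j], where [0 < i + j < p] as both are at most [h]. *)
Lemma squares_Fp_inj : injective (fun i : 'I_h => (i.+1%:Z ^+ 2)%:~R : 'F_p).
Proof.
move=> i j /= /eqP; rewrite !rmorphXn /= eqf_sqr => /orP[/eqP|].
  have lt_p (k : 'I_h) : (k.+1 < p)%N by have := ltn_ord k; lia.
  by move=> /(intr_Fp_inj p_pr (lt_p i) (lt_p j)) [] /val_inj.
have sum_bnd : (0 < i.+1 + j.+1 < p)%N.
  by have := ltn_ord i; have := ltn_ord j; lia.
by rewrite -addr_eq0 -rmorphD /= -PoszD (negbTE (intr_Fp_neq0 p_pr sum_bnd)).
Qed.

Lemma squares_Fp_roots (i : 'I_h) : (i.+1%:Z ^+ 2)%:~R ^+ h = 1 :> 'F_p.
Proof.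
rewrite rmorphXn /= -exprM mul2n; apply: (fermat_Fp p_pr).
by apply: (intr_Fp_neq0 p_pr); have := ltn_ord i; lia.
Qed.

Lemma prod_squares : \prod_(i < h) i.+1%:Z ^+ 2 = h`!%:Z ^+ 2.
Proof. by rewrite prodrXl prod_succ_fact. Qed.

Lemma per_scaled_squares (d : int) :
  (p%:Z ^+ 2 %| per (\matrix_(j < h, k < h) (j.+1%:Z ^+ 2 + d * k.+1%:Z ^+ 2))
     - (d ^+ h + 1) * h`!%:Z ^+ 3)%Z.
Proof.
have := @per_scaled_mod_sqr p d h (fun i => i.+1%:Z ^+ 2) h_gt0
  (fun r => @dvdz_elem_sym_Fp_roots _ p_pr _ _ r
              squares_Fp_inj squares_Fp_roots).
rewrite elem_sym_all prod_squares; congr (_ %| _ - _)%Z; ring.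
Qed.

(** If [d^h = 1] then [d] is a root of ['X^h - 1], which is the product of the
    ['X - i^2] for [1 <= i <= h]; so [d] is a square. Since [d^h] has square 1,
    it is [-1] when [d] is not a square. *)
Lemma euler_criterion (d : int) : ~~ (p%:Z %| d)%Z ->
  (p%:Z %| d ^+ h - legendre d p)%Z.
Proof.
move=> p_d; rewrite /legendre (negbTE p_d) dvdz_Fp // rmorphB rmorphXn /=.
have d_neq0 : d%:~R != 0 :> 'F_p by rewrite -dvdz_Fp.
case: ifPn => [/existsP[x]|no_sqrt].
  rewrite eqz_mod_dvd dvdz_Fp // rmorphB subr_eq0 rmorphXn /= => /eqP x_sqr.
  rewrite -x_sqr -exprM mul2n fermat_Fp ?subrr //.
  by move: d_neq0; rewrite -x_sqr sqrf_eq0.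
have : (d%:~R : 'F_p) ^+ h ^+ 2 == 1 by rewrite -exprM muln2 fermat_Fp.
rewrite sqrf_eq1 => /orP[/eqP dh1|/eqP ->]; last by rewrite rmorphN subrr.
case/negP: no_sqrt.
have := prod_XsubC_roots_unity h_gt0 squares_Fp_inj squares_Fp_roots.
move=> /(congr1 (horner^~ d%:~R)) /eqP.
rewrite horner_prod !hornerE dh1 subrr prodf_seq_eq0 => /hasP[i _].
rewrite !hornerE subr_eq0 => /eqP d_sqr.
have lt_ip : (i.+1 < p)%N by have := ltn_ord i; lia.
apply/existsP; exists (Ordinal lt_ip).
by rewrite eqz_mod_dvd dvdz_Fp // rmorphB /= d_sqr subrr.
Qed.

(** The permanent is [h! e_1 e_h (d + d^h)] modulo [p^2], where
    [24 e_1 = 4 h (h+1) (2 h + 1) = (p^2 - 1) p] and [e_h = (h!)^2], which is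
    [- (-1)^h] modulo [p]; as [p] divides [24 e_1], the other factors only matter
    modulo [p], where [d^h] is the Legendre symbol. *)
Lemma per_scaled_squares_zero (d : int) : (1 < h)%N -> ~~ (p%:Z %| d)%Z ->
  (p%:Z ^+ 2 %| 24 * per (\matrix_(j < h.+1, k < h.+1)
                            (j%:Z ^+ 2 + d * k%:Z ^+ 2))
     - (-1) ^+ h * p%:Z * (d + legendre d p) * h`!%:Z)%Z.
Proof.
move=> h_gt1 p_d; pose y (i : 'I_h.+1) := i%:Z ^+ 2.
have e_squares r : (r <= h)%N ->
    elem_sym y r = elem_sym (fun i : 'I_h => i.+1%:Z ^+ 2) r.
  by move=> le_rh; rewrite (@elem_sym_drop0 _ _ _ ord0).
have e_mid r : (0 < r < h)%N -> (p%:Z %| elem_sym y r)%Z.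
  move=> r_bnd; rewrite e_squares; last by lia.
  exact: dvdz_elem_sym_Fp_roots squares_Fp_inj squares_Fp_roots _.
have e_last : (p%:Z ^+ 2 %| h.+1`!%:Z * elem_sym y h.+1)%Z.
  by rewrite elem_sym_all (bigD1 ord0) //= [y ord0]expr0n mul0r mulr0 dvdz0.
have /dvdzP[c /eqP] := per_scaled_mod_sqr_S d h_gt1 e_mid e_last.
have /dvdzP[u /eqP] := euler_criterion p_d.
have /dvdzP[v] := prod_Fp_roots p_pr h_gt0 squares_Fp_inj squares_Fp_roots.
rewrite prod_squares => h_fact.
rewrite subr_eq => /eqP dh.
rewrite subr_eq e_squares ?(ltnW h_gt1) // e_squares // elem_sym_all.
rewrite prod_squares elem_sym1 dh => /eqP ->.
have := sum_succ_sqr h; set S := \sum_i _ => sumS.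
have S24 : 24 * S = (p%:Z ^+ 2 - 1) * p%:Z.
  rewrite (_ : 24 * S = 4 * (6 * S)); last by ring.
  by rewrite sumS -mul2n !intS PoszM; ring.
set L := legendre d p; set s := (-1) ^+ h.
(* [u] and [v] are the quotients by [p] in Euler's criterion and in the
   congruence for [(h!)^2]. *)
rewrite [24 * _](_ : _ = 24 * c * p%:Z ^+ 2
    + h`!%:Z * (24 * S) * h`!%:Z ^+ 2 * (d + (u * p%:Z + L))); last by ring.
have -> : h`!%:Z ^+ 2 = v * p%:Z - s by rewrite -h_fact addrK.
rewrite S24; apply/dvdzP; exists (24 * c + h`!%:Z *
  (p%:Z * (v * p%:Z - s) * (d + L + u * p%:Z)
    - v * (d + L + u * p%:Z) + s * u)).
ring.
Qed.

End Squares.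

(** * Identities and congruences for permanents *)

Theorem theorem2 :
  (forall (F : fieldType) (n : nat) (zeta : F),
     (0 < n)%N -> n.-primitive_root zeta ->
     (forall x : 'I_n -> F,
        per (\matrix_(j < n, k < n) (1 - zeta ^+ j.+1 * x k))
        = n`!%:R * (1 - \prod_(k < n) x k))
     /\
     ((1 < n)%N -> forall x : F,
        per (\matrix_(j < n.-1, k < n.-1) (1 + zeta ^+ (j.+1 + k.+1) * x))
        = \sum_(0 <= k < n) ((n.-1)`! %/ 'C(n.-1, k))%:R * x ^+ k))
  /\
  (forall p : nat, prime p -> odd p ->
     (forall x : 'I_p.-1 -> int,
        (per (\matrix_(j < p.-1, k < p.-1) (j.+1%:Z + x k))%R
         = (1 - \prod_(k < p.-1) x k)%R %[mod p%:Z])%Z)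
     /\
     (forall d : int, (d <> 0 %[mod p%:Z])%Z ->
        [/\ (per (\matrix_(j < p.-1, k < p.-1) (j.+1%:Z + d * k.+1%:Z))%R
             = (d ^+ p.-1 - 3 - 4 * (p.-1)`!%:Z)%R %[mod (p%:Z ^+ 2)%R])%Z,
            eqmod_pint p 2
              (per (\matrix_(j < p, k < p) (j.+1%:Z + d * k.+1%:Z)))%:~R
              ((d%:~R + 1) / 2 * p%:R)
          & eqmod_pint p 2
              (per (\matrix_(j < p, k < p) (j%:Z + d * k%:Z)))%:~R
              (- ((d%:~R + 1) / 2 * p%:R))])
     /\
     ((3 < p)%N -> forall d : int, (d <> 0 %[mod p%:Z])%Z ->
        (per (\matrix_(j < (p.-1)./2, k < (p.-1)./2)
                (j.+1%:Z ^+ 2 + d * k.+1%:Z ^+ 2))%R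
         = ((d ^+ (p.-1)./2 + 1) * ((p.-1)./2)`!%:Z ^+ 3)%R
             %[mod (p%:Z ^+ 2)%R])%Z
        /\
        eqmod_pint p 2
          (per (\matrix_(j < (p.-1)./2.+1, k < (p.-1)./2.+1)
                  (j%:Z ^+ 2 + d * k%:Z ^+ 2)))%:~R
          ((-1) ^+ (p.-1)./2 * (p%:R / 24) * (d%:~R + (legendre d p)%:~R)
             * ((p.-1)./2)`!%:R))).
Proof.
split=> [F n zeta n_gt0 zeta_prim|p p_pr p_odd].
  split=> [x|]; first exact: per_prim_root.
  case: n n_gt0 zeta_prim => // n _ zeta_prim _ x.
  exact: per_prim_root_pred.
have ndvd (d : int) : (d <> 0 %[mod p%:Z])%Z -> ~~ (p%:Z %| d)%Z.
  move=> d_neq0; apply/negP=> /dvdz_mod0P d0.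
  by apply: d_neq0; rewrite d0 mod0z.
have eqmod (q a b : int) : (q %| a - b)%Z -> (a = b %[mod q])%Z.
  by rewrite -eqz_mod_dvd => /eqP.
have p_coprime2 : coprime p 2 by rewrite coprimen2.
case: p p_pr p_odd => // m p_pr p_odd in ndvd p_coprime2 *.
split=> [x|]; first exact/eqmod/per_add_units_mod.
split=> [d /ndvd p_d|].
  split; first exact/eqmod/per_scaled_units.
  - have := eqmod_pint_div p_pr p_coprime2 (@per_scaled_residues _ p_pr
      (fun i => i.+1%:Z) ord_max 1 d p_odd _ _ _ p_d).
    rewrite mul1r rmorphM rmorphD /= mulrAC -pmulrn; apply.
    + by rewrite dvdzz.
    + by move=> i; rewrite /bump leqNgt ltn_ord subrr dvdz0.
    + by rewrite sum_succ !intS; ring.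
  - have := eqmod_pint_div p_pr p_coprime2 (@per_scaled_residues _ p_pr
      (fun i => i%:Z) ord0 (-1) d p_odd _ _ _ p_d).
    rewrite mulN1r mulNr rmorphN rmorphM rmorphD /= mulNr mulrAC -pmulrn; apply.
    + by rewrite dvdz0.
    + by move=> i; rewrite /= subrr dvdz0.
    + by rewrite big_ord_recl /= add0r sum_succ !intS; ring.
have [h m_eq] : exists h, m = h.*2.
  by exists m./2; rewrite -[LHS]odd_double_half; move: p_odd => /= /negbTE ->.
rewrite /= {m}m_eq doubleK in p_pr p_odd ndvd p_coprime2 * => p_gt3 d /ndvd p_d.
split; first exact/eqmod/per_scaled_squares.
have p_coprime24 : coprime h.*2.+1 24.
  rewrite (_ : 24 = 2 ^ 3 * 3)%N // coprimeMr coprimeXr //=.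
  by rewrite prime_coprime // dvdn_prime2 // gtn_eqF.
have h_gt1 : (1 < h)%N by lia.
have := eqmod_pint_div p_pr p_coprime24
  (per_scaled_squares_zero p_pr h_gt1 p_d).
rewrite !rmorphM rmorphXn rmorphN1 rmorphD /= -!pmulrn.
by congr (eqmod_pint _ _ _ _); ring.
Qed.
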